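(* Let $R$ be a $1$-dimensional Cohen--Macaulay (Noetherian) local ring and let $I$ be an ideal of $R$ that contains a non-zero-divisor. If $I$ is closed and reflexive, then $I$ is a principal ideal.
   Context: An ideal $I$ of $R$ is closed if $\operatorname{Hom}_R(I,I)=R$, i.e. the natural homothety map $R\to\operatorname{Hom}_R(I,I)$ is an isomorphism. Writing $E^*=\operatorname{Hom}_R(E,R)$ for an $R$-module $E$, the ideal $I$ is reflexive if the natural map $I\to I^{**}$ is an isomorphism. *)

(* Defs.v *)
From HB Require Import structures.
From mathcomp Require Import all_boot all_order all_algebra.
From mathcomp Require Import boolp.

Set Implicit Arguments.
Unset Strict Implicit.
Unset Printing Implicit Defensive.

Import GRing.Theory.
Local Open Scope ring_scope.

(* Ideals are the submodules of R^o, the unit ideal included, whereas idealr R  *)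
(* and prime_idealr R range over proper ideals only. All of these are boolean   *)
(* predicates, which is no restriction: by the axioms of boolp every            *)
(* proposition is reflected by a boolean.                                       *)
Notation ideal R := (submodClosed (R : comNzRingType)^o).

Section Hom.
Variables (R : comNzRingType) (E F : lmodType R).

Definition hom := {linear E -> F}.

Lemma hom_eqP (f g : hom) :
  (f : {linear E -> F}) =1 (g : {linear E -> F}) -> f = g.
Proof.
case: f g => [f [[fA] [fZ]]] [g [[gA] [gZ]]] /= /funext fg.
case: g / fg gA gZ => gA gZ.
by rewrite (Prop_irrelevance fA gA) (Prop_irrelevance fZ gZ).
Qed.

HB.instance Definition _ := gen_eqMixin hom.
HB.instance Definition _ := gen_choiceMixin hom.

Implicit Types (f g h : {linear E -> F}) (a b : R).

Definition hom0 : hom := (\0 : {linear E -> F}).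
Definition homN f : hom := (\- f : {linear E -> F}).
Definition homD f g : hom := (f \+ g : {linear E -> F}).
Definition homZ a f : hom := ( *:%R a \o f : {linear E -> F}).

Fact homDA : associative (homD : hom -> hom -> hom).
Proof. by move=> f g h; apply: hom_eqP => x /=; rewrite addrA. Qed.
Fact homDC : commutative (homD : hom -> hom -> hom).
Proof. by move=> f g; apply: hom_eqP => x /=; rewrite addrC. Qed.
Fact hom0D : left_id hom0 (homD : hom -> hom -> hom).
Proof. by move=> f; apply: hom_eqP => x /=; rewrite add0r. Qed.
Fact homND : left_inverse hom0 (homN : hom -> hom) homD.
Proof. by move=> f; apply: hom_eqP => x /=; rewrite addNr. Qed.

HB.instance Definition _ := GRing.isZmodule.Build hom homDA homDC hom0D homND.

Fact homZA a b (f : hom) : homZ a (homZ b f) = homZ (a * b) f.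
Proof. by apply: hom_eqP => x /=; rewrite scalerA. Qed.
Fact hom1Z : left_id 1 (homZ : R -> hom -> hom).
Proof. by move=> f; apply: hom_eqP => x /=; rewrite scale1r. Qed.
Fact homZDr : right_distributive (homZ : R -> hom -> hom) +%R.
Proof. by move=> a f g; apply: hom_eqP => x /=; rewrite scalerDr. Qed.
Fact homZDl (f : hom) : {morph (fun a => homZ a f : hom) : a b / a + b}.
Proof. by move=> a b; apply: hom_eqP => x /=; rewrite scalerDl. Qed.

HB.instance Definition _ :=
  GRing.Zmodule_isLmodule.Build R hom homZA hom1Z homZDr homZDl.

End Hom.

Section NaturalMaps.
Variables (R : comNzRingType) (E : lmodType R).

Definition homothety (a : R) : hom E E := ( *:%R a : {linear E -> E}).

Fact homothety_is_linear : linear (homothety : R^o -> hom E E).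
Proof. by move=> a b c; apply: hom_eqP => x /=; rewrite scalerDl -scalerA. Qed.

Definition dual : lmodType R := hom E (R^o).

End NaturalMaps.

Section Bidual.
Variables (R : comNzRingType) (E : lmodType R).

Definition evaluation (x : E) (f : dual E) : R^o := (f : {linear E -> R^o}) x.

Fact evaluation_is_linear (x : E) : linear (evaluation x).
Proof. by []. Qed.

HB.instance Definition _ (x : E) :=
  GRing.isLinear.Build R (dual E) (R^o) *:%R (evaluation x)
    (evaluation_is_linear x).

Definition bidual_map (x : E) : dual (dual E) :=
  (evaluation x : {linear dual E -> R^o}).

Fact bidual_map_is_linear : linear bidual_map.
Proof.
by move=> a x y; apply: hom_eqP => f; rewrite /= /evaluation linearP.
Qed.

End Bidual.

Section Ideals.
Variable R : comNzRingType.
Implicit Types (I : ideal R) (M : idealr R).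

Definition ideal_mod I := {x : R^o | x \in I}.
HB.instance Definition _ I := [isSub of ideal_mod I for sval].
HB.instance Definition _ I := [Choice of ideal_mod I by <:].
HB.instance Definition _ I := [SubChoice_isSubLmodule of ideal_mod I by <:].

(* homothety and bidual_map are linear, hence isomorphisms of R-modules as    *)
(* soon as they are bijective.                                                *)
Definition closed_ideal I := bijective (@homothety R (ideal_mod I)).
Definition reflexive_ideal I := bijective (@bidual_map R (ideal_mod I)).

Definition principal_ideal I :=
  exists a : R, forall x : R, x \in I <-> exists r : R, x = r * a.

Definition in_span (s : seq R) (x : R) :=
  exists c : nat -> R, x = \sum_(i < size s) c i * s`_i.

Definition noetherian :=
  forall I, exists s : seq R, forall x : R, x \in I <-> in_span s x.

Definition maximal_ideal M :=
  forall J : idealr R, {subset M <= J} -> {subset J <= M}.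

Definition local_ring :=
  exists2 M : idealr R,
    maximal_ideal M & forall M' : idealr R, maximal_ideal M' -> M' =i M.

(* Only the values of P at 0, ..., n matter. *)
Definition prime_chain (n : nat) (P : nat -> prime_idealr R) :=
  forall i, (i < n)%N ->
    {subset P i <= P i.+1} /\ ~ {subset P i.+1 <= P i}.

Definition krull_dim (d : nat) :=
  (exists P, prime_chain d P) /\
  (forall n P, prime_chain n P -> (n <= d)%N).

Definition regular_sequence (s : seq R) :=
  (forall i, (i < size s)%N -> forall y : R,
     in_span (take i s) (s`_i * y) -> in_span (take i s) y)
  /\ ~ in_span s 1.

(* The supremum of the lengths of the regular sequences in M is d. *)
Definition depth (M : idealr R) (d : nat) :=
  (exists s : seq R, [/\ size s = d, {subset s <= M} & regular_sequence s]) /\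
  (forall s : seq R,
     {subset s <= M} -> regular_sequence s -> (size s <= d)%N).

Definition cohen_macaulay_local :=
  [/\ noetherian, local_ring &
      forall M, maximal_ideal M -> exists2 d, krull_dim d & depth M d].

End Ideals.

(* Main.v *)
From HB Require Import structures.
Require Import Defs.
From mathcomp Require Import all_boot all_order all_algebra.
From mathcomp Require Import boolp.

(** Put m for the maximal ideal and fix a non-zero-divisor a in I. In the total
    ring of fractions, the dual of I is I^-1 = (R : I), and the products
    f(x), for x in I and f in the dual, are the products of elements of I and
    I^-1. If one of them is a unit of R, then I is invertible, and x generates
    it: f(x) y = f(y) x for every y in I.

    Otherwise I I^-1 is contained in m. Since R has dimension one, m is an
    associated prime of R/aR ([socle_mod_regular]): some c outside aR satisfies
    c m <= aR, which means that the fraction c/a lies in m^-1 but not in R. Then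
    c/a multiplies I^-1 into itself, hence multiplies I^** = I into itself,
    hence lies in Hom(I, I) = R, which is a contradiction. Fractions are avoided
    in the formal argument: multiplication by c/a is the quotient of a linear
    map by the regular element a ([hom_div]).

    To see that m is associated to R/aR, take among the ideals (aR : c) with c
    outside aR a maximal one P; it is prime and contains a ([prime_colon]). A
    prime containing a regular element is not minimal ([prime_below_regular]),
    so if P were strictly contained in m, there would be a chain of primes of
    length two. Both this lemma and [prime_colon] take a maximal element of a family
    of ideals, which exists because R is Noetherian. *)

Set Implicit Arguments.
Unset Strict Implicit.
Unset Printing Implicit Defensive.

Import GRing.Theory.
Local Open Scope ring_scope.

(** * Construction of ideals *)

Lemma ideal_of_closed (R : comNzRingType) (A : R -> Prop) :
  A 0 -> (forall r x y, A x -> A y -> A (r * x + y)) ->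
  exists J : ideal R, forall x : R, x \in J <-> A x.
Proof.
move=> A0 Alin.
pose S : {pred R^o} := fun x => `[< A x >].
have SP x : reflect (A x) (x \in S) by exact: asboolP.
have S_closed : submod_closed S.
  split; first exact/SP.
  by move=> r x y /SP Ax /SP Ay; apply/SP/Alin.
pose J : ideal R := HB.pack (S : R^o -> bool)
  (GRing.isSubmodClosed.Build R R^o S S_closed).
by exists J => x; split=> /SP.
Qed.

Lemma idealM (R : comNzRingType) (J : ideal R) (r x : R) : x \in J -> r * x \in J.
Proof. by move=> Jx; apply: (@rpredZ R R^o J r x Jx). Qed.

Lemma idealr_of_ideal (R : comNzRingType) (J : ideal R) :
  1 \notin (J : {pred R}) -> exists M : idealr R, M =i J.
Proof.
move=> J1.
have J_closed : idealr_closed (J : {pred R}).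
  split=> //; first exact: rpred0.
  by move=> r x y Jx Jy; apply: rpredD => //; apply: idealM.
pose M : idealr R := HB.pack (GRing.SubmodClosed.sort J : R -> bool)
  (isIdealr.Build R (GRing.SubmodClosed.sort J) J_closed).
by exists M.
Qed.

Lemma ideal_of_idealr (R : comNzRingType) (M : idealr R) :
  exists J : ideal R, J =i M.
Proof.
have [||J JP] := @ideal_of_closed R (fun x => x \in M).
- exact: rpred0.
- by move=> r x y Mx My; apply: rpredD => //; apply: idealMr.
by exists J => x; apply/idP/idP => /JP.
Qed.

Lemma prime_idealr_of_ideal (R : comNzRingType) (J : ideal R) :
  1 \notin (J : {pred R}) ->
  (forall x y : R, x * y \in J -> x \in J \/ y \in J) ->
  exists P : prime_idealr R, P =i J.
Proof.
move=> /idealr_of_ideal[M MJ] J_prime.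
have M_prime : prime_idealr_closed (M : {pred R}).
  by move=> x y; rewrite !MJ => /J_prime /orP.
pose P : prime_idealr R :=
  HB.pack (Idealr.sort M) M (isPrimeIdealrClosed.Build R M M_prime).
by exists P.
Qed.

(** * Maximal elements of families of ideals *)

(** A family without maximal element would contain, by dependent choice, a
    strictly increasing sequence; its union is an ideal, and finitely many
    generators of it already lie in one term of the sequence. *)
Lemma noetherian_maximal (R : comNzRingType) (F : ideal R -> Prop) (J0 : ideal R) :
  noetherian R -> F J0 ->
  exists2 J, F J & forall K, F K -> {subset J <= K} -> {subset K <= J}.
Proof.
move=> R_noeth FJ0; apply: contrapT => no_max.
have step (u : {J | F J}) : exists v : {J | F J},
    {subset sval u <= sval v} /\ ~ {subset sval v <= sval u}.
  case: u => J FJ /=; apply: contrapT => no_step.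
  apply: no_max; exists J => // K FK JK; apply: contrapT => nKJ.
  by apply: no_step; exists (exist _ K FK).
have [next nextP] := choice step.
pose C n := sval (iter n next (exist _ J0 FJ0)).
have C_step n : {subset C n <= C n.+1} by case: (nextP (iter n next (exist _ J0 FJ0))).
have C_mono m n : (m <= n)%N -> {subset C m <= C n}.
  move=> /subnK <-; elim: (n - m)%N => [//|k IHk] x /IHk.
  exact: C_step.
have [||U UP] := @ideal_of_closed R (fun x => exists n, x \in C n).
- by exists 0%N; apply: rpred0.
- move=> r x y [m Cx] [n Cy]; exists (maxn m n); apply: rpredD.
    by apply: idealM; apply: C_mono Cx; apply: leq_maxl.
  by apply: C_mono Cy; apply: leq_maxr.
have [s sP] := R_noeth U.
have s_in i : exists n, (i < size s)%N -> s`_i \in C n.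
  case: (ltnP i (size s)) => i_s; last by exists 0%N.
  suff /UP[n Cn] : s`_i \in U by exists n.
  apply/sP; exists (fun j => (j == i)%:R).
  rewrite (bigD1 (Ordinal i_s)) //= eqxx mul1r big1 ?addr0 // => j.
  by rewrite -val_eqE /= => /negPf->; rewrite mul0r.
have [h hP] := choice s_in.
pose N := \max_(i < size s) h i.
have UN (x : R) : x \in U -> x \in C N.
  move=> /sP[c ->]; apply: rpred_sum => i _; apply: idealM.
  by apply: C_mono (hP i (ltn_ord i)); apply: (leq_bigmax i).
case: (nextP (iter N next (exist _ J0 FJ0))) => _; apply=> x Cx.
by apply: UN; apply/UP; exists N.+1.
Qed.

(** A nonunit generates a proper ideal, and a maximal proper ideal above it must
    be the only maximal ideal. *)
Lemma local_unit (R : comNzRingType) (M : idealr R) (x : R) :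
  noetherian R -> local_ring R -> maximal_ideal M -> x \notin M ->
  exists y, y * x = 1.
Proof.
move=> R_noeth [M0 _ M0_uniq] M_max; apply: contraNP => x_nonunit.
have [||J0 J0P] := @ideal_of_closed R (fun z => exists r, z = r * x).
- by exists 0; rewrite mul0r.
- by move=> r _ _ [p ->] [q ->]; exists (r * p + q); rewrite mulrDl mulrA.
have J0_proper : (1 : R) \notin (J0 : {pred R}).
  by apply/negP => /J0P[y yx1]; apply: x_nonunit; exists y.
have J0x : x \in J0 by apply/J0P; exists 1; rewrite mul1r.
have [J [J_proper Jx] J_max] := @noetherian_maximal R
  (fun K => (1 : R) \notin (K : {pred R}) /\ x \in K) J0 R_noeth (conj J0_proper J0x).
have [N NJ] := @idealr_of_ideal R J J_proper.
have N_max : maximal_ideal N.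
  move=> K NK y Ky; have [K' K'K] := ideal_of_idealr K.
  rewrite NJ; apply: (J_max K'); last by rewrite K'K.
    by rewrite K'K idealr1; split=> //; rewrite K'K NK // NJ.
  by move=> z Jz; rewrite K'K NK // NJ.
by rewrite (M0_uniq M M_max) -(M0_uniq N N_max) NJ.
Qed.

(** If neither x nor y is in Q, then Q + xR and Q + yR both meet the
    multiplicative set S, and so does their product, which is contained in
    Q + xyR. *)
Lemma disjoint_maximal_prime (R : comNzRingType) (S : R -> Prop) (Q : ideal R) :
  (forall s t, S s -> S t -> S (s * t)) ->
  (forall s, S s -> s \notin (Q : {pred R})) ->
  (forall K : ideal R, (forall s, S s -> s \notin (K : {pred R})) ->
     {subset Q <= K} -> {subset K <= Q}) ->
  forall x y : R, x * y \in Q -> x \in Q \/ y \in Q.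
Proof.
move=> SM Q_disj Q_max x y Qxy.
have meets z : z \notin (Q : {pred R}) -> exists q r, q \in Q /\ S (q + r * z).
  move=> nQz; apply: contrapT => no_meet.
  have [||K KP] := @ideal_of_closed R (fun t => exists q r, q \in Q /\ t = q + r * z).
  - by exists 0, 0; rewrite mul0r addr0; split=> //; apply: rpred0.
  - move=> r _ _ [q1 [r1 [Qq1 ->]]] [q2 [r2 [Qq2 ->]]].
    exists (r * q1 + q2), (r * r1 + r2); split.
      by apply: rpredD => //; apply: idealM.
    by rewrite mulrDr mulrDl mulrA addrACA.
  move/negP: nQz; apply; apply: (Q_max K).
  - move=> s Ss; apply/negP => /KP[q [r [Qq sE]]].
    by apply: no_meet; exists q, r; rewrite -sE.
  - by move=> q Qq; apply/KP; exists q, 0; rewrite mul0r addr0.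
  - by apply/KP; exists 0, 1; rewrite mul1r add0r; split=> //; apply: rpred0.
apply: contrapT => /not_orP[/negP/meets[q1 [r1 [Qq1 S1]]]].
move=> /negP/meets[q2 [r2 [Qq2 S2]]].
have /negP := Q_disj _ (SM _ _ S1 S2); apply.
rewrite mulrDl; apply: rpredD; first by rewrite mulrC; apply: idealM.
rewrite mulrDr; apply: rpredD; first exact: idealM.
by rewrite mulrACA; apply: idealM.
Qed.

(** A prime containing a regular element is not minimal. The products s a^n with
    s outside P form a multiplicative set, which does not contain 0 because a is
    regular; an ideal maximal among those disjoint from it is the required Q. *)
Lemma prime_below_regular (R : comNzRingType) (P : prime_idealr R) (a : R) :
  noetherian R -> GRing.lreg a -> a \in P ->
  exists2 Q : prime_idealr R, {subset Q <= P} & a \notin Q.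
Proof.
move=> R_noeth a_reg Pa.
pose S x := exists s n, s \notin P /\ x = s * a ^+ n.
have S1 : S 1 by exists 1, 0%N; rewrite idealr1 mulr1.
have SM x y : S x -> S y -> S (x * y).
  move=> [s [m [Ps ->]]] [t [n [Pt ->]]]; exists (s * t), (m + n)%N.
  by rewrite prime_idealrM negb_or Ps Pt mulrACA exprD.
have [||Z ZP] := @ideal_of_closed R (fun x => x = 0).
- by [].
- by move=> r _ _ -> ->; rewrite mulr0 addr0.
have Z_disj s : S s -> s \notin (Z : {pred R}).
  move=> [t [n [Pt ->]]]; apply/negP => /ZP; rewrite mulrC => ta0.
  suff t0 : t = 0 by move: Pt; rewrite t0 rpred0.
  have aX_reg : GRing.lreg (a ^+ n) by apply: lregX.
  by apply: aX_reg; rewrite ta0 mulr0.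
have [Q Q_disj Q_max] := @noetherian_maximal R
  (fun K => forall s, S s -> s \notin (K : {pred R})) Z R_noeth Z_disj.
have [|Q' Q'Q] := @prime_idealr_of_ideal R Q (Q_disj _ S1).
  exact: disjoint_maximal_prime SM Q_disj Q_max.
exists Q' => [x|].
  rewrite Q'Q; apply: contraLR => Px; apply: Q_disj.
  by exists x, 0%N; rewrite mulr1.
rewrite Q'Q; apply: Q_disj; exists 1, 1%N.
by rewrite idealr1 mul1r.
Qed.

(** * The maximal ideal is associated to R/aR *)

(** P is an associated prime of R/aR: a maximal one among the ideals (aR : c)
    with c outside aR. If xy is in (aR : c) but y is not, then (aR : yc) belongs
    to the same family and contains (aR : c), hence is equal to it; and it
    contains x. *)
Lemma prime_colon (R : comNzRingType) (a : R) :
  noetherian R -> ~ (exists r, 1 = a * r) ->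
  exists (P : prime_idealr R) (c : R),
    ~ (exists r, c = a * r) /\ (forall x, x \in P <-> exists r, x * c = a * r).
Proof.
move=> R_noeth a_nonunit.
have colon c : exists J : ideal R, forall x, x \in J <-> exists r, x * c = a * r.
  apply: ideal_of_closed => [|r x y [p xc] [q yc]].
    by exists 0; rewrite mul0r mulr0.
  by exists (r * p + q); rewrite mulrDl -mulrA xc yc mulrDr (mulrCA r).
pose F (K : ideal R) := exists c, ~ (exists r, c = a * r) /\
  (forall x : R, x \in K <-> exists r, x * c = a * r).
have [J1 J1P] := colon 1.
have FJ1 : F J1 by exists 1.
have [J [c [ac JP]] J_max] := noetherian_maximal R_noeth FJ1.
have J_proper : 1 \notin (J : {pred R}).
  by apply/negP => /JP[r]; rewrite mul1r => cr; apply: ac; exists r.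
have [|P PJ] := @prime_idealr_of_ideal R J J_proper.
  move=> x y Jxy; have [|ayc] := pselect (exists r, y * c = a * r).
    by move/JP; right.
  left; have [K KP] := colon (y * c).
  apply: (J_max K); first by exists (y * c).
    move=> z /JP[r zc]; apply/KP; exists (y * r).
    by rewrite mulrCA zc mulrCA.
  by apply/KP; rewrite mulrA; apply/JP.
by exists P, c; split=> // x; rewrite PJ.
Qed.

(** Depth one in the form in which it is used below: c/a is an element of m^-1
    outside R. *)
Lemma socle_mod_regular (R : comNzRingType) (M : idealr R) (a : R) :
  noetherian R -> local_ring R -> krull_dim R 1 -> maximal_ideal M ->
  GRing.lreg a -> a \in M ->
  exists2 c, ~ (exists r, c = a * r) & forall x, x \in M -> exists r, x * c = a * r.
Proof.
move=> R_noeth R_local [_ dim_le1] M_max a_reg Ma.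
have a_nonunit : ~ (exists r, 1 = a * r).
  move=> [r ar1]; have := idealr1 M.
  by rewrite ar1 mulrC idealMr.
have [P [c [ac PP]]] := prime_colon R_noeth a_nonunit.
exists c => // x Mx; apply/PP; move: x Mx.
have PM : {subset P <= M}.
  move=> x Px; apply: contraT => /(local_unit R_noeth R_local M_max)[y yx1].
  by rewrite -(idealr1 P) -yx1 idealMr.
apply: contrapT => nMP.
have Pa : a \in P by apply/PP; exists c.
have [Q QP Qa] := prime_below_regular R_noeth a_reg Pa.
have M_prime : prime_idealr_closed (M : {pred R}).
  move=> x y; apply: contraLR; rewrite negb_or => /andP[].
  move=> /(local_unit R_noeth R_local M_max)[x' x'x].
  move=> /(local_unit R_noeth R_local M_max)[y' y'y].
  apply/negP => Mxy; have := idealr1 M.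
  by rewrite -[1]mulr1 -{1}x'x -y'y mulrACA idealMr.
pose M' : prime_idealr R :=
  HB.pack (Idealr.sort M) M (isPrimeIdealrClosed.Build R M M_prime).
pose C n := nth M' [:: Q; P] n.
suff /dim_le1 : prime_chain 2 C by [].
case=> [|[|//]] _ /=; split=> //.
by move=> PQ; move: Qa; rewrite PQ.
Qed.

(** * Homomorphisms of ideals *)

(** Replaces multiplication by a fraction with denominator a: the values of h/a
    are uniquely determined, which makes h/a linear. *)
Lemma hom_div (R : comNzRingType) (E F : lmodType R) (a : R) (h : Defs.hom E F) :
  injective ( *:%R a : F -> F) ->
  (forall x, exists y, a *: y = (h : {linear E -> F}) x) ->
  exists g : Defs.hom E F,
    forall x, a *: (g : {linear E -> F}) x = (h : {linear E -> F}) x.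
Proof.
move=> a_inj /choice[g gP].
have g_lin : linear g.
  move=> r x y; apply: a_inj.
  by rewrite scalerDr scalerA mulrC -scalerA !gP linearP.
pose g' : {linear E -> F} := HB.pack g (GRing.isLinear.Build R E F *:%R g g_lin).
by exists g'.
Qed.

(** Both sides are f(xy). If x is regular, this says that f is multiplication by
    the fraction f(x)/x. *)
Lemma ideal_homC (R : comNzRingType) (I : ideal R) (f : dual (ideal_mod I))
    (x y : ideal_mod I) :
  val x * (f : {linear ideal_mod I -> R^o}) y =
  val y * (f : {linear ideal_mod I -> R^o}) x.
Proof.
have -> : forall u v : ideal_mod I,
   val u * (f : {linear ideal_mod I -> R^o}) v =
   (f : {linear ideal_mod I -> R^o}) ((val u : R) *: v).
  by move=> u v; rewrite linearZ.
rewrite -linearZ; congr ((f : {linear _ -> _}) _).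
by apply: val_inj; rewrite !linearZ; apply: mulrC.
Qed.

Theorem proposition4p5 (R : comNzRingType) (I : ideal R)
    (R_cm : cohen_macaulay_local R) (R_dim1 : krull_dim R 1)
    (I_regular : exists2 a : R, a \in I & GRing.lreg a)
    (I_closed : closed_ideal I) (I_reflexive : reflexive_ideal I) :
  principal_ideal I.
Proof.
case: R_cm => R_noeth R_local _; have [M M_max _] := R_local.
case: I_regular => a Ia a_reg.
pose a' : ideal_mod I := exist _ (a : R^o) Ia.
pose ev (f : dual (ideal_mod I)) := (f : {linear ideal_mod I -> R^o}).
have [[f [x nMfx]]|f_in_M] := pselect (exists f x, ev f x \notin M).
  have [u ufx] := local_unit R_noeth R_local M_max nMfx.
  exists (val x) => y; split=> [Iy|[r ->]]; last exact/idealM/valP.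
  exists (u * ev f (exist _ (y : R^o) Iy)).
  rewrite -mulrA [ev f _ * _]mulrC ideal_homC mulrCA -/(ev f x) ufx.
  by rewrite mulr1.
have {}f_in_M f x : ev f x \in M by apply: contra_notT f_in_M => ?; exists f, x.
pose incl : dual (ideal_mod I) := (val : {linear ideal_mod I -> R^o}).
have Ma : a \in M := f_in_M incl a'.
have [c ac cM] := socle_mod_regular R_noeth R_local R_dim1 M_max a_reg Ma.
have a_injR : injective ( *:%R a : R^o -> R^o) by exact: a_reg.
have a_injI : injective ( *:%R a : ideal_mod I -> ideal_mod I).
  by move=> x y /(congr1 val); rewrite !linearZ => /a_injR /val_inj.
(* c/a maps I into I: for x in I, the linear form f |-> (c/a) f(x) on the dual
   is evaluation at some y by reflexivity, and taking the inclusion of I in R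
   for f gives a y = c x. *)
have cI x : exists y, a *: y = homothety (ideal_mod I) c x.
  pose h : dual (dual (ideal_mod I)) := c *: bidual_map x.
  have [f|Phi PhiP] := @hom_div R _ _ a h a_injR.
    have [r cfx] := cM _ (f_in_M f x).
    by exists r; rewrite -[RHS]mulrC.
  have [ev_inv _ evK] := I_reflexive.
  exists (ev_inv Phi); apply: val_inj; rewrite !linearZ.
  by have := PhiP incl; rewrite -[Phi in LHS]evK.
have [g gP] := hom_div a_injI cI.
have [hom_inv _ homK] := I_closed.
(* Multiplication by c/a, as an endomorphism of I, is a homothety. *)
have [r gE] : exists r, g = homothety (ideal_mod I) r.
  by exists (hom_inv g); rewrite homK.
case: ac; exists r; apply: a_reg.
have := congr1 val (gP a'); rewrite gE /= !linearZ /= /GRing.scale /=.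
by move=> ra_ca; rewrite mulrC -ra_ca mulrCA [r * a]mulrC.
Qed.
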